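(* Consider the undiscounted ($\gamma=1$) Markov Reward Process with states $1,2,3$, starting state $2$, terminal state $3$, transitions $2\to1$ with probability $p$, $2\to 3$ with probability $1-p$ and $1\to 2$ with probability $1$, reward $1$ for the transition $2\to1$ and reward $0$ for the other transitions, where $p\in(0,1)$ is unknown. Let $n\ge1$ i.i.d. paths be observed. There is no estimator $\bar p$ (a function of the observed paths with values in $[0,1)$) such that the value estimators $V_i(\bar p)$ are unbiased for all states $i$, i.e. such that $\mathbb E_p[V_i(\bar p)\mid N_i\ge 1]=V_i(p)$ for all states $i$ and all $p\in(0,1)$.
   Context: For $q\in[0,1)$, $V_i(q)$ denotes the value (expected total future reward) of state $i$ in the undiscounted ($\gamma=1$) Markov Reward Process with states $1,2,3$, starting state $2$, terminal state $3$, transitions $2\to1$ with probability $q$, $2\to3$ with probability $1-q$ and $1\to2$ with probability $1$, reward $1$ for the transition $2\to1$ and reward $0$ for the other transitions; thus $V_1(q)=V_2(q)=q/(1-q)$ and $V_3(q)=0$. $N_i$ is the total number of visits to state $i$ in the observed paths. *)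

(* Defs.v *)
From HB Require Import structures.
From mathcomp Require Import all_boot all_order all_algebra.
From mathcomp Require Import all_classical all_reals all_analysis.

Set Implicit Arguments.
Unset Strict Implicit.
Unset Printing Implicit Defensive.

Import Order.TTheory GRing.Theory Num.Theory.

Local Open Scope classical_set_scope.
Local Open Scope ring_scope.

Section pmf_measure.
Context d (T : measurableType d) (R : realType) (f : T -> {nonneg R}).

Definition pmf_measure (A : set T) : \bar R :=
  (\esum_(x in A) ((f x)%:num)%:E)%E.

Let pmf0 : pmf_measure set0 = 0%E.
Proof. by rewrite /pmf_measure esum_set0. Qed.

Let pmf_ge0 A : (0 <= pmf_measure A)%E.
Proof. by apply: esum_ge0 => x _; rewrite lee_fin. Qed.

Let pmf_sigma_additive : semi_sigma_additive pmf_measure.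
Proof.
move=> F mF tF mUF; rewrite /pmf_measure nneseries_sum_bigcup//.
by apply: is_cvg_ereal_nneg_natsum => n _; exact: pmf_ge0.
Qed.

HB.instance Definition _ := isMeasure.Build _ _ _ pmf_measure
  pmf0 pmf_ge0 pmf_sigma_additive.

End pmf_measure.

Definition state := 'I_3.
Definition s1 : state := @Ordinal 3 0 isT.
Definition s2 : state := @Ordinal 3 1 isT.
Definition s3 : state := @Ordinal 3 2 isT.

Definition param (R : realType) := {q : R | 0 <= q < 1}.

Section process.
Context {R : realType}.
Implicit Types (q : param R) (x y i : state).

Definition trans q x y : R :=
  if (x, y) == (s2, s1) then sval q
  else if (x, y) == (s2, s3) then 1 - sval q
  else if (x, y) == (s1, s2) then 1
  else 0.

Definition reward x y : R := ((x, y) == (s2, s1))%:R.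

End process.

(* An observed path is the list of all visited states, the initial and the terminal one
   included.  Infinite paths have probability 0 since q < 1, and are left out; lists that
   are not paths get probability 0 in [path_prob]. *)
Definition episode := seq state.

HB.instance Definition _ := Choice.on episode.
HB.instance Definition _ := Countable.on episode.
HB.instance Definition _ := isPointed.Build episode [::].
HB.instance Definition _ := @isMeasurable.Build default_measure_display episode
  discrete_measurable discrete_measurable0 discrete_measurableC
  discrete_measurableU.

Section path_law.
Context {R : realType}.
Implicit Types (q : param R) (x y i : state) (w : episode).

(* Probability of visiting exactly the states of [w] after [x], and then
   stopping; [s3] has no outgoing transition. *)
Fixpoint run_prob q x w : R :=
  if w is y :: w' then trans q x y * run_prob q y w' else (x == s3)%:R.

Definition path_prob q i w : R :=
  if w is x :: w' then (x == i)%:R * run_prob q x w' else 0.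

Definition total_reward w : R :=
  if w is x :: w' then \sum_(r <- pairmap reward x w') r else 0.

Lemma param_ge0 q : 0 <= sval q. Proof. by case: q => q /= /andP[]. Qed.

Lemma param_lt1 q : sval q < 1. Proof. by case: q => q /= /andP[]. Qed.

Lemma trans_ge0 q x y : 0 <= trans q x y.
Proof.
rewrite /trans; case: ifP => _; first exact: param_ge0.
case: ifP => _; first by rewrite subr_ge0 ltW// param_lt1.
by case: ifP.
Qed.

Lemma run_prob_ge0 q x w : 0 <= run_prob q x w.
Proof.
by elim: w x => [|y w IH] x /=; [exact: ler0n|rewrite mulr_ge0// trans_ge0].
Qed.

Lemma path_prob_ge0 q i w : 0 <= path_prob q i w.
Proof. by case: w => // x w; rewrite mulr_ge0// run_prob_ge0. Qed.

Definition path_pmf q i w : {nonneg R} := NngNum (path_prob_ge0 q i w).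

(* The law of the process started in [i] and run until it terminates. *)
Definition path_law q i : set episode -> \bar R := pmf_measure (path_pmf q i).

HB.instance Definition _ q i := Measure.on (path_law q i).

Definition run2 (k : nat) : episode := iter k (fun w => [:: s1, s2 & w]) [:: s3].

Lemma run_prob_run2 q k : run_prob q s2 (run2 k) = (1 - sval q) * sval q ^+ k.
Proof.
elim: k => [|k IH]; first by rewrite /= /trans /= expr0.
by rewrite [run2 _]/= [LHS]/= IH /trans /= mul1r exprS mulrCA.
Qed.

Lemma run_prob_s2_eq0 q w : ~ range run2 w -> run_prob q s2 w = 0.
Proof.
have [n] := ubnP (size w); elim: n w => // n IH [|y [|z w]]//=.
- move=> _ nr; rewrite /trans; case: y nr => -[|[|[|//]]] /= ly nr.
  + by rewrite mulr0.
  + by rewrite mul0r.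
  + by case: nr; exists 0%N => //=; congr cons; exact/val_inj.
- move=> sw nr; case: y nr => -[|[|[|//]]] /= ly nr.
  + case: z nr => -[|[|[|//]]] /= lz nr.
    * by rewrite {2}/trans /= mul0r mulr0.
    * rewrite (_ : Ordinal lz = s2) ?IH ?mulr0//; last exact/val_inj.
        by rewrite -ltnS (leq_trans _ sw)// ltnS leqnSn.
      move=> [k _ kw]; apply: nr; exists k.+1 => //=; rewrite kw.
      by congr [:: _, _ & _]; exact/val_inj.
    * by rewrite {2}/trans /= mul0r mulr0.
  + by rewrite /trans /= mul0r.
  + by rewrite {2}/trans /= mul0r mulr0.
Qed.

Local Open Scope ereal_scope.

Lemma esum_run_prob_s2 q : \esum_(w in [set: episode]) (run_prob q s2 w)%:E = 1.
Proof.
have run2_inj : set_inj [set: nat] run2.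
  move=> k l _ _ /(congr1 size).
  have sz j : size (run2 j) = j.*2.+1 by elim: j => //= j ->.
  by rewrite !sz => -[/double_inj].
rewrite (_ : \esum_(w in _) _ =
    \esum_(w in run2 @` [set: nat]) (run_prob q s2 w)%:E); last first.
  rewrite [RHS]esum_mkcond; apply: eq_esum => w _.
  by case: ifPn => //; rewrite notin_setE => /run_prob_s2_eq0 ->.
rewrite esum_image// -nneseries_esumT; last first.
  by move=> n; rewrite lee_fin run_prob_ge0.
apply/cvg_lim => //; rewrite (_ : (fun _ => _) =
    EFin \o series (geometric (1 - sval q)%R (sval q))); last first.
  apply/funext => n /=; rewrite /series /= -sumEFin.
  by apply: eq_bigr => k _; rewrite run_prob_run2.
apply: cvg_EFin; first exact: nearW.
have qn : (1 - sval q != 0)%R by rewrite subr_eq0 eq_sym lt_eqF// param_lt1.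
rewrite -[X in _ --> X](divff qn); apply: cvg_geometric_series.
by rewrite ger0_norm ?param_lt1// param_ge0.
Qed.

Lemma esum_run_prob q x : \esum_(w in [set: episode]) (run_prob q x w)%:E = 1.
Proof.
have rp_ge0 y w : 0 <= (run_prob q y w)%:E by rewrite lee_fin run_prob_ge0.
case: x => -[|[|[|//]]] lx.
- rewrite -(esum_run_prob_s2 q) (_ : \esum_(w in _) (run_prob q _ w)%:E =
    \esum_(w in (cons s2) @` [set: episode]) (run_prob q s1 w)%:E); last first.
    rewrite [RHS]esum_mkcond (_ : Ordinal lx = s1); last exact/val_inj.
    apply: eq_esum => w _; case: ifPn => //; rewrite notin_setE; case: w => //= y w.
    case: y => -[|[|[|//]]] ly nr; rewrite /trans /= ?mul0r//.
    by case: nr; exists w => //; congr cons; exact/val_inj.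
  rewrite esum_image; last by move=> ? ? _ _ [].
  by apply: eq_esum => w _; rewrite /= /trans /= mul1r.
- by rewrite (_ : Ordinal lx = s2) ?esum_run_prob_s2//; exact/val_inj.
- rewrite (_ : Ordinal lx = s3); last exact/val_inj.
  rewrite (_ : \esum_(w in _) _ =
    \esum_(w in [set [::] : episode]) (run_prob q s3 w)%:E).
    by rewrite esum_set1.
  rewrite [RHS]esum_mkcond; apply: eq_esum => w _; case: ifPn => //.
  rewrite notin_setE /=; case: w => //= y w _.
  by rewrite /trans /= mul0r.
Qed.

Lemma path_law_setT q i : path_law q i [set: episode] = 1.
Proof.
rewrite /path_law /pmf_measure -(esum_run_prob q i).
rewrite (_ : \esum_(w in _) ((path_pmf q i w)%:num)%:E =
  \esum_(w in (cons i) @` [set: episode]) (path_prob q i w)%:E); last first.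
  rewrite [RHS]esum_mkcond; apply: eq_esum => w _; case: ifPn => //.
  rewrite notin_setE; case: w => //= y w nr.
  have [yi|] := eqVneq y i; last by rewrite mul0r.
  by case: nr; exists w; rewrite // yi.
rewrite esum_image; last by move=> ? ? _ _ [].
by apply: eq_esum => w _; rewrite /= eqxx mul1r.
Qed.

HB.instance Definition _ q i :=
  Measure_isProbability.Build _ _ _ (path_law q i) (path_law_setT q i).

End path_law.

Section tuple_mass.
Context {R : realType} {T : pointedType}.
Local Open Scope ereal_scope.

Lemma ge0_esumZl (T' : choiceType) (A : set T') (r : R) (f : T' -> \bar R) :
  (0 <= r)%R -> (forall x, 0 <= f x) ->
  \esum_(x in A) (r%:E * f x) = r%:E * \esum_(x in A) f x.
Proof.
move=> r0 f0; rewrite /esum -ereal_supZl//; last first.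
  by apply/set0P; exists 0, set0; [exact: fsets_set0|rewrite fsbig_set0].
congr ereal_sup; rewrite image_comp; apply: eq_imagel => F _ /=.
by rewrite ge0_mule_fsumr.
Qed.

Lemma esum_tuple_prod n (f : T -> R) : (forall x, 0 <= f x)%R ->
  \esum_(x in [set: T]) (f x)%:E = 1 ->
  \esum_(X in [set: n.-tuple T]) (\prod_(j < n) f (tnth X j))%:E = 1.
Proof.
move=> f0 f1; elim: n => [|n IH].
  rewrite (_ : [set: _] = [set [tuple]]).
    by rewrite esum_set1 big_ord0// lee_fin.
  by apply/seteqP; split => X //= _; rewrite tuple0.
pose e (xX : T * n.-tuple T) := [the n.+1.-tuple T of xX.1 :: xX.2].
rewrite (reindex_esum ([set: T] `*`` (fun=> [set: n.-tuple T])) _ e); last first.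
  split => //.
  - by move=> [x X] [y Y] _ _ [-> XY]; congr pair; exact/val_inj.
  - move=> X _; exists (thead X, [tuple of behead X]) => //.
    by case/tupleP: X => x X; apply: val_inj; rewrite /= theadE.
rewrite (_ : \esum_(k in _) _ = \esum_(k in [set: T] `*`` (fun=> [set: n.-tuple T]))
    ((f k.1)%:E * (\prod_(j < n) f (tnth k.2 j))%:E)); last first.
  apply: eq_esum => -[x X] _ /=; rewrite -EFinM big_ord_recl; congr (_ * _)%:E.
  by apply: eq_bigr => j _; rewrite /e /= tnthS.
have p0 X : 0 <= (\prod_(j < n) f (tnth X j))%:E by rewrite lee_fin prodr_ge0.
rewrite -(esum_esum (a := fun x X =>
    (f x)%:E * (\prod_(j < n) f (tnth X j))%:E)); last first.
  by move=> x X _ _; rewrite mule_ge0// lee_fin.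
rewrite -[RHS]f1; apply: eq_esum => x _.
by rewrite ge0_esumZl// IH mule1.
Qed.

End tuple_mass.

Section sample.
Context {R : realType} (n : nat).
Implicit Types (p : param R) (i : state) (X : n.-tuple episode).

Definition sample_prob p X : R := \prod_(j < n) path_prob p s2 (tnth X j).

Lemma sample_prob_ge0 p X : 0 <= sample_prob p X.
Proof. by apply: prodr_ge0 => j _; exact: path_prob_ge0. Qed.

Definition sample_pmf p X : {nonneg R} := NngNum (sample_prob_ge0 p X).

(* The law of [n] independent paths of the process started in [s2]. *)
Definition sample_law p : set (n.-tuple episode) -> \bar R :=
  pmf_measure (sample_pmf p).

HB.instance Definition _ p := Measure.on (sample_law p).

Lemma sample_law_setT p : sample_law p [set: n.-tuple episode] = 1%E.
Proof.
have := @esum_tuple_prod R episode n _ (path_prob_ge0 p s2).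
by apply; rewrite -(path_law_setT p s2).
Qed.

HB.instance Definition _ p :=
  Measure_isProbability.Build _ _ _ (sample_law p) (sample_law_setT p).

Definition visits i X : nat := (\sum_(w <- X) count_mem i w)%N.

End sample.

Local Open Scope ereal_scope.

Definition value {R : realType} (q : param R) (i : state) : \bar R :=
  'E_(path_law q i)[total_reward].

(* Conditioning on an event; only meaningful when [P A] is positive. *)
Definition cond_expectation d (T : measurableType d) (R : realType)
    (P : probability T R) (X : T -> \bar R) (A : set T) : \bar R :=
  (\int[P]_(w in A) X w) / P A.

(* Main.v *)
(* Since [V_1 = V_2], both conditions concern the same random variable [V].  A sample never
   visits state 1 exactly when all its paths are [2, 3], so [E V = V(p)] and
   [E(V | N_1 >= 1) = V(p)] together force the value of [V] on this single sample to be
   [V(p)] for every [p], although [V(p)] depends on [p]. *)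
Require Import Defs.
From mathcomp Require Import all_boot all_order all_algebra.
From mathcomp Require Import all_classical all_reals all_analysis.
From mathcomp Require Import measurable_realfun ring lra.

Set Implicit Arguments.
Unset Strict Implicit.
Unset Printing Implicit Defensive.

Import Order.TTheory GRing.Theory Num.Theory.

Local Open Scope classical_set_scope.
Local Open Scope ring_scope.

(** * Integration on spaces where every set is measurable *)

Section discrete_integral.
Context {d : measure_display} {T : measurableType d} {R : realType}.
Variables (mu : {measure set T -> \bar R}) (g : T -> \bar R).
Hypothesis measurable_all : forall A : set T, measurable A.
Hypothesis g_ge0 : forall x, (0 <= g x)%E.

Lemma integral_singleton x : (\int[mu]_(y in [set x]) g y = g x * mu [set x])%E.
Proof.
rewrite (@eq_integral _ _ _ _ _ (cst (g x))) ?integral_cst//.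
by move=> y /[!inE] ->.
Qed.

(** A null complement leaves only the range of [e], which injectivity turns into a disjoint union of
    singletons, each contributing one term. *)
Lemma integral_range_enum (e : nat -> T) : injective e -> mu (~` range e) = 0%E ->
  (\int[mu]_x g x = \sum_(0 <= k <oo) g (e k) * mu [set e k])%E.
Proof.
move=> e_inj e0.
rewrite (ge0_negligible_integral _ _ _ _ e0)//.
rewrite setTD setCK -bigcup_imset1 ge0_integral_bigcup//.
- by apply: eq_eseriesr => k _; exact: integral_singleton.
- apply/trivIsetP => i j _ _ ij; apply/seteqP; split => // x [-> /e_inj /eqP].
  by rewrite (negbTE ij).
Qed.

Lemma integral_eq_set (A B N : set T) : mu N = 0%E -> A `\` N = B `\` N ->
  (\int[mu]_(x in A) g x = \int[mu]_(x in B) g x)%E.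
Proof.
move=> N0 AB.
rewrite (ge0_negligible_integral _ _ _ _ N0)//.
rewrite AB -(ge0_negligible_integral _ _ _ _ N0)//.
Qed.

End discrete_integral.

(** Singletons are finite intersections of coordinate preimages, and there are only countably many
    tuples. Hence an arbitrary estimator raises no measurability question. *)
Lemma measurable_episode_tuple n (A : set (n.-tuple episode)) : measurable A.
Proof.
have m1 (X : n.-tuple episode) : measurable [set X].
  rewrite (_ : [set X] = \bigcap_(j in [set: 'I_n])
      ((@tnth n episode)^~ j @^-1` [set tnth X j])).
    apply: fin_bigcap_measurable => // j _; rewrite -[X in measurable X]setTI.
    exact: measurable_tnth.
  apply/seteqP; split => [Y -> //|Y XY]; apply: eq_from_tnth => j.
  exact: XY.
rewrite -(image_id A) -bigcup_imset1 bigcup_mkcond.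
apply: countable_bigcupT_measurable => [|X]; first exact: countableP.
by case: ifP.
Qed.

Section pmf.
Context d (T : measurableType d) (R : realType) (f : T -> {nonneg R}).

Lemma pmf_measure_set1 x : pmf_measure f [set x] = (f x)%:num%:E.
Proof. by rewrite /pmf_measure esum_set1. Qed.

Lemma pmf_measure_eq0 (A : set T) : (forall x, A x -> (f x)%:num = 0) ->
  pmf_measure f A = 0%E.
Proof. by move=> f0; apply: esum1 => x /f0 ->. Qed.

End pmf.

(** * The value function: series, bounds, non-constancy *)

Lemma run2_inj : injective run2.
Proof.
have size_run2 k : size (run2 k) = k.*2.+1 by elim: k => //= k ->.
by move=> k l /(congr1 size); rewrite !size_run2 => -[/double_inj].
Qed.

Section value_formula.
Context {R : realType}.
Implicit Types q : param R.

Lemma total_reward_run2 k : total_reward (s2 :: run2 k) = k%:R :> R.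
Proof.
elim: k => [|k IH]; first by rewrite /= big_cons big_nil addr0.
rewrite /total_reward/= in IH *; rewrite !big_cons.
by rewrite IH /reward/= add0r nat1r.
Qed.

Lemma total_reward_ge0 (w : episode) : 0 <= total_reward w :> R.
Proof.
case: w => [|x w]//=; elim: w x => [|y w IH] x /=; rewrite ?big_nil//.
by rewrite big_cons addr_ge0// ler0n.
Qed.

(** Serves both starting states 1 and 2: in each case the possible paths are enumerated by the
    number [k] of moves from 2 to 1, which is geometrically distributed and equals the total
    reward. *)
Lemma value_enum q i (e : nat -> episode) : injective e ->
  (forall k, path_prob q i (e k) = (1 - sval q) * sval q ^+ k) ->
  (forall w, ~ range e w -> path_prob q i w = 0) ->
  (forall k, total_reward (e k) = k%:R :> R) ->
  value q i = (\sum_(0 <= k <oo) (k%:R * ((1 - sval q) * sval q ^+ k))%:E)%E.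
Proof.
move=> e_inj pe p0 re.
rewrite /value unlock (@integral_range_enum _ _ _ _ _ _ _ e)//.
- by apply: eq_eseriesr => k _; rewrite re -pe EFinM -(pmf_measure_set1 (path_pmf q i)).
- by move=> w; rewrite lee_fin total_reward_ge0.
- by apply: pmf_measure_eq0 => w /= /p0.
Qed.

Lemma path_prob_s2_eq0 q w :
  ~ range (fun k => s2 :: run2 k) w -> path_prob q s2 w = 0.
Proof.
case: w => //= x w nr; have [xE|] := eqVneq x s2; last by rewrite mul0r.
rewrite xE run_prob_s2_eq0 ?mulr0// => -[k _ kw].
by apply: nr; exists k; rewrite // kw xE.
Qed.

Lemma path_prob_s2_run2 q k :
  path_prob q s2 (s2 :: run2 k) = (1 - sval q) * sval q ^+ k.
Proof. by rewrite /= mul1r run_prob_run2. Qed.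

Lemma value_s2 q :
  value q s2 = (\sum_(0 <= k <oo) (k%:R * ((1 - sval q) * sval q ^+ k))%:E)%E.
Proof.
apply: (@value_enum q s2 (fun k => s2 :: run2 k)).
- by move=> k l [/run2_inj].
- exact: path_prob_s2_run2.
- exact: path_prob_s2_eq0.
- exact: total_reward_run2.
Qed.

(** The forced move from 1 to 2 has probability 1 and reward 0, so prefixing [s1] to a path from
    [s2] changes neither its probability nor its reward. *)
Lemma value_s1 q : value q s1 = value q s2.
Proof.
rewrite value_s2; apply: (@value_enum q s1 (fun k => [:: s1, s2 & run2 k])).
- by move=> k l [/run2_inj].
- by move=> k; rewrite /= run_prob_run2 /trans/= !mul1r.
- case=> [|x [|y w]]//= nr; first by case: eqP => [->|_]; rewrite ?mul0r ?mulr0.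
  have [xE|] := eqVneq x s1; last by rewrite mul0r.
  have [yE|ys2] := eqVneq y s2; last first.
    by rewrite xE /trans/= !xpair_eqE/= (negbTE ys2) mul0r mulr0.
  rewrite xE yE run_prob_s2_eq0 ?mulr0// => -[k _ kw].
  by apply: nr; exists k; rewrite // kw xE yE.
- move=> k; rewrite /total_reward/= big_cons {1}/reward/= add0r.
  exact: total_reward_run2.
Qed.

Let term_ge0 q k : 0 <= k%:R * ((1 - sval q) * sval q ^+ k).
Proof.
by rewrite !mulr_ge0 ?exprn_ge0 ?param_ge0// subr_ge0 ltW// param_lt1.
Qed.

Lemma value_s2_ge0 q : (0 <= value q s2)%E.
Proof. by rewrite value_s2; apply: nneseries_ge0 => k _ _; rewrite lee_fin. Qed.

(** Keeps only the terms [k = 0] and [k = 1]. Together with the upper bound that follows, this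
    separates two values of V without evaluating the series. *)
Lemma value_s2_ge q : ((sval q * (1 - sval q))%:E <= value q s2)%E.
Proof.
rewrite value_s2; apply: le_trans (nneseries_lim_ge 2 _); last first.
  by move=> k _ _; rewrite lee_fin.
by rewrite big_nat_recr//= big_nat1 -EFinD lee_fin; lra.
Qed.

Lemma value_s2_le q : (value q s2 <= (sval q / (1 - sval q))%:E)%E.
Proof.
have q0 := param_ge0 q; have q1 := param_lt1 q.
have d0 : 0 < 1 - sval q by rewrite subr_gt0.
(* Closed form of the partial sums; dropping the subtracted term and the factor [1 - sval q ^+ n]
   bounds them uniformly in [n]. *)
have sumE n : \sum_(0 <= k < n) k%:R * ((1 - sval q) * sval q ^+ k) =
    sval q * (1 - sval q ^+ n) / (1 - sval q) - n%:R * sval q ^+ n.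
  elim: n => [|n IH]; first by rewrite big_nil expr0 subrr; ring.
  rewrite big_nat_recr//= IH exprS -natr1; field.
  by rewrite gt_eqF.
rewrite value_s2; apply: lime_le.
  by apply: is_cvg_nneseries => k _ _; rewrite lee_fin.
apply: nearW => n; rewrite sumEFin lee_fin sumE.
have qn : 0 <= sval q ^+ n by rewrite exprn_ge0.
rewrite lerBlDr -[leLHS]addr0 lerD// ?mulr_ge0//.
by rewrite ler_pM2r ?invr_gt0// ler_piMr// gerBl.
Qed.

Lemma value_s2_fin_num q : value q s2 \is a fin_num.
Proof.
by rewrite ge0_fin_numE ?value_s2_ge0// (le_lt_trans (value_s2_le q))// ltry.
Qed.

Lemma value_not_constant (c : \bar R) :
  ~ forall q, 0 < sval q -> value q s2 = c.
Proof.
move=> cV.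
have half01 : 0 <= (2^-1 : R) < 1 by apply/andP; split; lra.
have tenth01 : 0 <= (10^-1 : R) < 1 by apply/andP; split; lra.
(* The lower bound at 1/2 is 1/4, while the upper bound at 1/10 is 1/9. *)
have := value_s2_ge (exist (fun q : R => 0 <= q < 1) _ half01); rewrite cV/=; last lra.
have := value_s2_le (exist (fun q : R => 0 <= q < 1) _ tenth01); rewrite cV/=; last lra.
move=> /[swap] /le_trans /[apply]; rewrite lee_fin.
rewrite (_ : 10^-1 / (1 - 10^-1) = 9^-1); first lra.
by field.
Qed.

End value_formula.

(** * Samples of positive probability and the states they visit *)

Section samples.
Context {R : realType} {n : nat}.
Implicit Types (p : param R) (X : n.-tuple episode).

Definition direct_sample : n.-tuple episode := [tuple of nseq n [:: s2; s3]].

Lemma sample_prob_direct p : sample_prob p direct_sample = (1 - sval p) ^+ n.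
Proof.
rewrite /sample_prob (eq_bigr (fun=> 1 - sval p)) ?prodr_const ?card_ord// => j _.
by rewrite tnth_nseq (path_prob_s2_run2 p 0) expr0 mulr1.
Qed.

(** A coordinate of any other shape would put a zero factor into the product. *)
Lemma sample_prob_neq0 p X : sample_prob p X != 0 ->
  forall w, w \in X -> exists k, w = s2 :: run2 k.
Proof.
move=> X0 w /tnthP[j ->]; apply: contrapT => nk; move/eqP: X0; apply.
rewrite /sample_prob (bigD1 j)//= path_prob_s2_eq0 ?mul0r// => -[k _ kw].
by apply: nk; exists k.
Qed.

Lemma visits_gt0 i X w : w \in X -> i \in w -> (0 < visits i X)%N.
Proof.
move=> wX iw; rewrite /visits (big_rem w)//= addn_gt0.
by rewrite -has_count has_pred1 iw.
Qed.

Lemma visits_s2_gt0 p X : (0 < n)%N -> sample_prob p X != 0 -> (0 < visits s2 X)%N.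
Proof.
move=> n0 X0; have jX := mem_tnth (Ordinal n0) X.
have [k kw] := sample_prob_neq0 X0 jX.
by apply: visits_gt0 jX _; rewrite kw mem_head.
Qed.

Lemma visits_s1_direct : visits s1 direct_sample = 0%N.
Proof. by rewrite /visits big1_seq// => w /= /nseqP[->]. Qed.

(** A path with [k = 0] is the direct one, and every larger [k] passes through state 1; avoiding 1
    in all coordinates therefore leaves only [direct_sample]. *)
Lemma visits_s1_gt0 p X : sample_prob p X != 0 -> X <> direct_sample ->
  (0 < visits s1 X)%N.
Proof.
move=> X0 Xd; rewrite lt0n; apply/eqP => v0; apply: Xd; apply: val_inj => /=.
rewrite -[in RHS](size_tuple X); apply/all_pred1P/allP => w wX /=.
have [[|k] kw] := sample_prob_neq0 X0 wX; first by rewrite kw.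
by have := visits_gt0 (i := s1) wX; rewrite v0 kw !inE => /(_ isT).
Qed.

End samples.

(** * Comparison of the two unbiasedness conditions *)

Theorem lemma1 (R : realType) (n : nat) (n_ge1 : (1 <= n)%N) :
  ~ exists pbar : n.-tuple episode -> param R,
      forall p : param R, 0 < sval p ->
      forall i : state,
        cond_expectation (sample_law (n := n) p)
          (fun X => value (pbar X) i) [set X | (1 <= visits i X)%N]
        = value p i.
Proof.
move=> [pbar unb].
apply: (@value_not_constant R (value (pbar direct_sample) s2)) => p p0.
pose g X := value (pbar X) s2.
pose mu : probability (n.-tuple episode) R := sample_law p.
pose visited i := [set X : n.-tuple episode | (1 <= visits i X)%N].
have unb2 : cond_expectation mu g (visited s2) = value p s2 := unb p p0 s2.
have unb1 : cond_expectation mu g (visited s1) = value p s2.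
  rewrite -value_s1 -(unb p p0 s1); congr (cond_expectation _ _ _).
  by apply/funext => X; rewrite value_s1.
(* Tuples of lists that are not genuine paths may visit no state at all, so the events below are
   compared only outside this null set. *)
pose N := [set X : n.-tuple episode | sample_prob p X = 0].
have N0 : mu N = 0%E by exact: pmf_measure_eq0.
have g0 X : (0 <= g X)%E by exact: value_s2_ge0.
have mA := @measurable_episode_tuple n.
pose c := (1 - sval p) ^+ n.
have q_gt0 : 0 < 1 - sval p by rewrite subr_gt0 param_lt1.
have c_gt0 : 0 < c by rewrite exprn_gt0.
(* Here [n >= 1] and [p > 0] enter: the event of visiting state 1 gets positive probability [1 - c],
   so conditioning on it is meaningful. *)
have c_lt1 : c < 1 by rewrite exprn_ilt1 -?lt0n ?ltW// gtrBl.
have mu_direct : mu [set direct_sample] = c%:E.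
  by rewrite -[LHS]/(pmf_measure (sample_pmf p) _) pmf_measure_set1/= sample_prob_direct.
(* State 2 is visited almost surely, so the condition for state 2 is about the plain expectation. *)
have visitedT2 : visited s2 `\` N = setT `\` N.
  apply/seteqP; split => X [] // _ XN; split => //.
  exact: (visits_s2_gt0 n_ge1 (introN eqP XN)).
have visitedT1 : (visited s1 `|` [set direct_sample]) `\` N = setT `\` N.
  apply/seteqP; split => X [] // _ XN; split => //.
  have [->|/eqP Xd] := eqVneq X direct_sample; [by right|left].
  exact: (visits_s1_gt0 (introN eqP XN) Xd).
have visited_direct : [disjoint visited s1 & [set direct_sample]].
  apply/disj_setPS => X [/= + XE].
  by rewrite XE /visited/= visits_s1_direct.
(* The measure of [B] is read off as the integral of the constant 1. *)
have muE B : B `\` N = setT `\` N -> mu B = 1%E.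
  move=> /(integral_eq_set (g := cst 1%E) mA (fun=> lee01) N0).
  by rewrite !integral_cst// !mul1e => ->; exact: probability_setT.
have intE B : B `\` N = setT `\` N ->
    (\int[mu]_(X in B) g X = \int[mu]_X g X)%E.
  exact: integral_eq_set.
have mu_visited1 : mu (visited s1) = (1 - c)%:E.
  have muU : (1 = mu (visited s1) + mu [set direct_sample])%E.
    by rewrite -(muE _ visitedT1) measureU//; exact/disj_set2P.
  by rewrite EFinB muU mu_direct addeK.
have int_direct :
    (\int[mu]_(X in [set direct_sample]) g X = g direct_sample * c%:E)%E.
  by rewrite integral_singleton// -mu_direct.
move: unb2 unb1; rewrite /cond_expectation.
rewrite (intE _ visitedT2) (muE _ visitedT2) inve1 mule1 -(intE _ visitedT1).
rewrite ge0_integral_setU// int_direct mu_visited1 inver subr_eq0 gt_eqF//.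
rewrite -/(g direct_sample).
rewrite -[value p s2]fineK ?value_s2_fin_num//.
rewrite -[g direct_sample]fineK ?value_s2_fin_num//.
(* With [v] for V(p), [u] for V at the direct sample and [r] for the integral over visits to 1, the
   conditions read [r + u * c = v] and [r / (1 - c) = v]. Hence [u * c = v * c]. An infinite
   integral would contradict the finiteness of [v]. *)
move: (fine _) (fine _) => v u.
have : (0 <= \int[mu]_(X in visited s1) g X)%E by exact: integral_ge0.
case: (\int[mu]_(X in visited s1) g X)%E => [r _|_|//]; last by rewrite addye.
rewrite -!EFinM -EFinD => -[ru] [rv].
have rE : r = v * (1 - c) by rewrite -rv divfK// subr_eq0 gt_eqF.
by congr EFin; apply: (mulIf (lt0r_neq0 c_gt0)); lra.
Qed.
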